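(* Let $X$ be a noncontractible compact space and let $x\in X$ be any base point. Then $AC(X,x)$ is also a noncontractible compact space.
   Context: $\mathbb{I}=[0,1]$. Alternating cone $AC(X,x)$ of a pointed space $(X,x)$: let $(X_n,x_n)$, $n\in\mathbb{N}=\{1,2,3,\dots\}$, be disjoint copies of $(X,x)$. For each $n$ connect $x_n$ to $x_{n+1}$ by an arc $J_n$ (a copy of $[0,1]$ whose endpoints $0$ and $1$ are identified with $x_n$ and $x_{n+1}$, respectively, distinct arcs meeting only at common endpoints $x_n$), and let $Z$ be the resulting quotient of the topological sum of all $X_n$ and all $J_n$. Let $Y=Z\cup\{\infty\}$ where $\infty$ is a new point, $Z$ is an open subspace of $Y$ carrying its own topology, and the sets $\{\infty\}\cup\bigcup_{n>m}(X_n\cup J_n)\cup(J_m\setminus\{x_m\})$, $m\in\mathbb{N}$, form an open neighborhood base at $\infty$ (so each neighborhood of $\infty$ contains almost all $X_n$ and almost all $J_n$). Then $AC(X,x)$ is the quotient space of $Y\times\mathbb{I}$ obtained by collapsing, for every odd $n$, the set $X_n\times\{0\}$ to the point $(x_n,0)$ and, for every even $n$, the set $X_n\times\{1\}$ to the point $(x_n,1)$. *)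

(* Defs.v *)
From HB Require Import structures.
From Stdlib Require Import Relation_Operators.
From mathcomp Require Import all_boot all_order all_algebra.
From mathcomp Require Import generic_quotient.
From mathcomp Require Import all_classical all_reals all_analysis.

Set Implicit Arguments.
Unset Strict Implicit.
Unset Printing Implicit Defensive.

Import Order.TTheory GRing.Theory Num.Theory.
Import numFieldNormedType.Exports.

Local Open Scope classical_set_scope.
Local Open Scope ring_scope.
Local Open Scope quotient_scope.

Section Gluing.
Variables (T : topologicalType) (r : T -> T -> Prop).

Definition glue_eqb (a b : T) : bool := `[< clos_refl_sym_trans T r a b >].

Lemma glue_eqb_refl : reflexive glue_eqb.
Proof. by move=> a; apply/asboolP; exact: rst_refl. Qed.

Lemma glue_eqb_sym : symmetric glue_eqb.
Proof. by move=> a b; apply/asboolP/asboolP; exact: rst_sym. Qed.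

Lemma glue_eqb_trans : transitive glue_eqb.
Proof.
by move=> b a c /asboolP ab /asboolP bc; apply/asboolP; exact: rst_trans bc.
Qed.

Canonical glue_equiv :=
  EquivRel glue_eqb glue_eqb_refl glue_eqb_sym glue_eqb_trans.

(* The quotient of [T] by the least equivalence relation containing [r] *)
Definition glued : topologicalType := quotient_topology {eq_quot glue_equiv}.

Definition glue_pi (a : T) : glued := \pi_{eq_quot glue_equiv} a.

End Gluing.

Definition uinterval (R : realType) : topologicalType :=
  set_type (`[0, 1]%classic : set R).

Section Contractible.
Variable R : realType.

Definition contractible (T : topologicalType) : Prop :=
  exists (c : T) (H : T * uinterval R -> T),
    [/\ continuous H,
        forall (p : T) (t : uinterval R), \val t = 0 -> H (p, t) = p
      & forall (p : T) (t : uinterval R), \val t = 1 -> H (p, t) = c].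

End Contractible.

(* The copies are indexed by [n : nat] starting from 0, so index [n] stands for
   the positive integer [n.+1]; hence the parity conditions in [AC_collapse]. *)
Section AlternatingCone.
Variables (R : realType) (X : topologicalType) (x : X).

Local Notation I := (uinterval R).

(* [inl n] indexes the n-th copy of X, [inr n] the arc J_n. *)
Definition chain_piece (i : nat + nat) : topologicalType :=
  match i with inl _ => X | inr _ => I end.

Definition chain_sum : topologicalType := {i : nat + nat & chain_piece i}.

Definition sumX (n : nat) (p : X) : chain_sum := existT chain_piece (inl n) p.
Definition sumJ (n : nat) (t : I) : chain_sum := existT chain_piece (inr n) t.

Definition chain_rel (a b : chain_sum) : Prop :=
  exists (n : nat) (t : I), a = sumJ n t /\
    (\val t = 0 /\ b = sumX n x \/ \val t = 1 /\ b = sumX n.+1 x).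

(* The space Z: the point 0 (resp. 1) of J_n is identified with the base point
   of the n-th (resp. (n+1)-st) copy of X. *)
Definition chain_space : topologicalType := glued chain_rel.

Definition chainX (n : nat) : set chain_space :=
  range (fun p : X => glue_pi chain_rel (sumX n p)).
Definition chainJ (n : nat) : set chain_space :=
  range (fun t : I => glue_pi chain_rel (sumJ n t)).
Definition chain_base (n : nat) : chain_space := glue_pi chain_rel (sumX n x).

(* The space Y; [None] is the point at infinity. *)
Definition chain_infty : Type := option chain_space.

HB.instance Definition _ := Choice.on chain_infty.

Definition infty_base (m : nat) : set chain_infty :=
  [set None] `|`
  Some @` ((\bigcup_(n in [set n | (m < n)%N]) (chainX n `|` chainJ n))
           `|` (chainJ m `\ chain_base m)).

(* [infty_base m] is the basic neighborhood of infinity with index [m]; the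
   other basic open sets of Y are the open sets of Z. *)
Definition chain_infty_open (U : set chain_infty) : Prop :=
  open (Some @^-1` U) /\ (U None -> exists m, infty_base m `<=` U).

Lemma infty_base_anti (m n : nat) :
  (m <= n)%N -> infty_base n `<=` infty_base m.
Proof.
rewrite leq_eqVlt => /predU1P[->//|mn] y [->|[z [[k /= nk zk]|[zn _]] <-]].
- by left.
- by right; exists z => //; left; exists k => //=; exact: ltn_trans nk.
- by right; exists z => //; left; exists n => //; right.
Qed.

Lemma chain_infty_openT : chain_infty_open setT.
Proof. by split; [rewrite preimage_setT; exact: openT | exists 0%N]. Qed.

Lemma chain_infty_openI : setI_closed chain_infty_open.
Proof.
move=> U V [oU iU] [oV iV]; split; first by rewrite preimage_setI; exact: openI.
move=> [/iU[m mU] /iV[n nV]]; exists (maxn m n) => y ymn; split.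
- by apply: mU; apply: infty_base_anti ymn; exact: leq_maxl.
- by apply: nV; apply: infty_base_anti ymn; exact: leq_maxr.
Qed.

Lemma chain_infty_open_bigU (K : Type) (f : K -> set chain_infty) :
  (forall k, chain_infty_open (f k)) -> chain_infty_open (\bigcup_k f k).
Proof.
move=> of_; split.
- by rewrite preimage_bigcup; apply: bigcup_open => k _; have [] := of_ k.
- move=> [k _ fk]; have [_ /(_ fk)[m mk]] := of_ k.
  by exists m => y /mk fy; exists k.
Qed.

HB.instance Definition _ := isOpenTopological.Build chain_infty
  chain_infty_openT chain_infty_openI chain_infty_open_bigU.

Definition AC_collapse (a b : chain_infty * I) : Prop :=
  exists n : nat,
    [/\ (Some @` chainX n) a.1, (Some @` chainX n) b.1
      & odd n.+1 /\ \val a.2 = 0 /\ \val b.2 = 0 \/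
        ~~ odd n.+1 /\ \val a.2 = 1 /\ \val b.2 = 1].

Definition alternating_cone : topologicalType :=
  glued (AC_collapse : (chain_infty * I)%type -> _ -> Prop).

End AlternatingCone.

(* Main.v *)
Require Import Defs.
From Stdlib Require Import Relation_Operators.
From mathcomp Require Import all_boot all_order all_algebra.
From mathcomp Require Import generic_quotient.
From mathcomp Require Import all_classical all_reals all_analysis.
From mathcomp Require Import lra zify.

(** Compactness is soft: every neighborhood of infinity in Y contains all but
    finitely many of the compact pieces of the chain, so Y is compact, and the
    alternating cone is a continuous image of the product of Y with [0, 1].

    For the other half, let H be a contraction of the alternating cone.  The
    n-th copy of X times [0, 1] has become a cone, whose vertex is at height
    e_n, which is 0 or 1 according to the parity of n.  Away from this vertex
    the cone projects to X, and the rest of the space can be sent along to the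
    base point ([cone_proj], [cone_proj_continuous]).  Put the n-th copy of X at
    height u, follow H until time s, and project: if the vertex of the n-th cone
    is avoided this is a map from X to X, and the pair (u, s) is called
    essential for n when that map is defined and not homotopic to a constant.
    - At s = 0 and u <> e_n the map is the identity of X, so (u, s) is
      essential, because X is not contractible ([essential_start]).
    - At s = 1, and on the whole edge u = e_n, the map is constant or undefined
      ([not_essential_end], [not_essential_level]).
    - If a box of pairs contains essential and inessential ones, then somewhere
      in the box H hits the vertex of the n-th cone, hence takes the height e_n
      there ([essential_change_height]).

    Take n even and n' odd.  Essentiality for n and for n' are two colorings of
    the square of all pairs (u, s); the first is true on the bottom edge except
    at its left end and false on the left and top edges, the second is true on
    the bottom edge except at its right end and false on the right and top
    edges.  A parity count shows that in every subdivision of the square into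
    small cells there is a cell where neither coloring is constant
    ([grid_crossing]).  In this cell H attains the height 0 along the n-th
    copy, and the height 1 along the n'-th copy.  But if n and n' are large,
    both copies are close to the point at infinity, and by compactness of the
    square the heights that H reaches from them in one small cell differ by
    less than 1 ([height_near_infty]): a contradiction. *)

Set Implicit Arguments.
Unset Strict Implicit.
Unset Printing Implicit Defensive.

Import Order.TTheory GRing.Theory Num.Theory.
Import numFieldNormedType.Exports.

Local Open Scope classical_set_scope.
Local Open Scope ring_scope.
Local Open Scope quotient_scope.

(** * A combinatorial crossing lemma for the square *)

Definition cell_constant (A : nat -> nat -> bool) (i j : nat) : Prop :=
  [/\ A i.+1 j = A i j, A i j.+1 = A i j & A i.+1 j.+1 = A i j].

(** Count the edges of the grid along which A changes while B is true at both
    ends.  If A or B is constant on a cell, then this number is even for the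
    boundary of the cell.  Summing over all cells, every inner edge counts
    twice, so if no cell is as claimed the number is even for the boundary of
    the square.  It is 1: only the first edge of the bottom side qualifies. *)
Lemma grid_crossing (N : nat) (A B : nat -> nat -> bool) : (1 < N)%N ->
  (forall j, A 0%N j = false) -> (forall j, B N j = false) ->
  (forall i, A i N = false) ->
  (forall i, (0 < i <= N)%N -> A i 0%N) -> (forall i, (i < N)%N -> B i 0%N) ->
  exists i j, [/\ (i < N)%N, (j < N)%N,
    ~ cell_constant A i j & ~ cell_constant B i j].
Proof.
move=> N1 Aleft Bright Atop Abot Bbot; apply: contrapT => none.
have cell i j : (i < N)%N -> (j < N)%N ->
    cell_constant A i j \/ cell_constant B i j.
  move=> iN jN; apply: contrapT => /not_orP[nA nB].
  by apply: none; exists i, j.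
(* the counted horizontal and vertical edges, as bits *)
pose h i j := [&& B i j, B i.+1 j & A i j (+) A i.+1 j].
pose v i j := [&& B i j, B i j.+1 & A i j (+) A i j.+1].
pose S i k := \big[addb/false]_(j < k) v i j.
(* the cells of the i-th column, up to height k, added up modulo 2 *)
have column i k : (i < N)%N -> (k <= N)%N ->
    h i 0%N (+) h i k = S i k (+) S i.+1 k.
  move=> iN; elim: k => [|k IHk] kN; first by rewrite /S !big_ord0 addbb.
  rewrite /S !big_ord_recr /= -!/(S _ _).
  have := IHk (ltnW kN).
  have : h i k (+) h i k.+1 = v i k (+) v i.+1 k.
    rewrite /h /v; case: (cell i k iN kN) => -[-> -> ->].
      by rewrite addbb !andbF.
    case: (B i k) => //=.
    by case: (A i k); case: (A i.+1 k); case: (A i k.+1); case: (A i.+1 k.+1).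
  move=> e1 e2; rewrite addbACA -e2 -addbA.
  by rewrite -[h i k.+1](addKb (h i k)) e1 addbA.
(* the first m columns together enclose the only counted bottom edge *)
have Sm m : (m <= N)%N -> S m N = (0 < m)%N.
  elim: m => [_|m IHm mN].
    by rewrite /S big1 // => j _; rewrite /v !Aleft !andbF.
  have hN : h m N = false by rewrite /h !Atop !andbF.
  have := column m N mN (leqnn N); rewrite hN addbF (IHm (ltnW mN)) {hN}.
  have -> : h m 0%N = (m == 0%N).
    rewrite /h; case: m mN {IHm} => [|m] mN.
      by rewrite Aleft (Abot 1%N mN) (Bbot 0%N mN) (Bbot 1%N N1).
    by rewrite (Abot m.+1 (ltnW mN)) (Abot m.+2 mN) !andbF.
  by move: (S m.+1 N) => b; case: m {IHm mN} => [|m] /=; case: b.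
have := Sm N (leqnn N); rewrite (ltnW N1) /S big1 // => j _.
by rewrite /v !Bright.
Qed.

(** * Products and homotopies *)

Section Products.
Variables (S T U : topologicalType).

Lemma fst_continuous : continuous (fst : T * U -> T).
Proof. by move=> p; exact: cvg_fst. Qed.

Lemma snd_continuous : continuous (snd : T * U -> U).
Proof. by move=> p; exact: cvg_snd. Qed.

Lemma pair_continuous (f : S -> T) (g : S -> U) :
  continuous f -> continuous g -> continuous (fun s => (f s, g s)).
Proof. by move=> cf cg s; exact: (cvg_pair (cf s) (cg s)). Qed.

Lemma comp_continuous (f : S -> T) (g : T -> U) :
  continuous f -> continuous g -> continuous (g \o f).
Proof. by move=> cf cg s; apply: continuous_comp; [exact: cf | exact: cg]. Qed.

End Products.

Section Homotopy.
Variables (R : realType) (X Y : topologicalType).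

(** The time runs through all of R rather than [0, 1], so that times can be
    reparametrized by affine maps without truncation. *)
Definition homotopic (f g : X -> Y) : Prop :=
  exists K : X * R -> Y, [/\ continuous K,
    forall p, K (p, 0) = f p & forall p, K (p, 1) = g p].

Lemma homotopic_trans (f g k : X -> Y) :
  homotopic f g -> homotopic g k -> homotopic f k.
Proof.
move=> [K [cK K0 K1]] [L [cL L0 L1]].
pose M (q : X * R) :=
  if q.2 <= 2^-1 then K (q.1, 2 * q.2) else L (q.1, 2 * q.2 - 1).
have cK2 : continuous (fun q : X * R => K (q.1, 2 * q.2)).
  apply: (@comp_continuous _ _ _ (fun q : X * R => (q.1, 2 * q.2)) K) => //.
  apply: pair_continuous; first exact: fst_continuous.
  by move=> q; apply: cvgM; [exact: cvg_cst | exact: snd_continuous].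
have cL2 : continuous (fun q : X * R => L (q.1, 2 * q.2 - 1)).
  apply: (@comp_continuous _ _ _ (fun q : X * R => (q.1, 2 * q.2 - 1)) L) => //.
  apply: pair_continuous; first exact: fst_continuous.
  move=> q; apply: cvgB; last exact: cvg_cst.
  by apply: cvgM; [exact: cvg_cst | exact: snd_continuous].
exists M; split => [|p|p]; rewrite /M /=; last 2 first.
- by rewrite invr_ge0 ler0n mulr0 K0.
- by rewrite ifF; [rewrite mulr1 -L1; congr (L (_, _)); lra | apply/negP; lra].
have cl1 : closed [set q : X * R | q.2 <= 2^-1].
  apply: (@preimage_closed _ _ (fun q : X * R => q.2)
    [set t : R | t <= 2^-1]); last exact: closed_le.
  by move=> q _; exact: cvg_snd.
have cl2 : closed [set q : X * R | 2^-1 <= q.2].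
  apply: (@preimage_closed _ _ (fun q : X * R => q.2)
    [set t : R | 2^-1 <= t]); last exact: closed_ge.
  by move=> q _; exact: cvg_snd.
apply/continuous_closedP => C clC.
rewrite (_ : M @^-1` C =
    ([set q | q.2 <= 2^-1] `&` (fun q => K (q.1, 2 * q.2)) @^-1` C) `|`
    ([set q | 2^-1 <= q.2] `&` (fun q => L (q.1, 2 * q.2 - 1)) @^-1` C)).
  apply: closedU; apply: closedI => //.
  - by move/continuous_closedP : cK2; exact.
  - by move/continuous_closedP : cL2; exact.
have mid p t : t = 2^-1 :> R -> K (p, 2 * t) = L (p, 2 * t - 1).
  by move=> ->; rewrite divff ?pnatr_eq0 // subrr K1 L0.
apply/seteqP; split => -[p t]; rewrite /M /=.
- by case: ifPn => [t2|/negP t2] Ct; [left | right; split => //; lra].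
- case=> -[t2 Ct]; first by rewrite t2.
  by case: ifPn => // t2'; rewrite mid //; lra.
Qed.

End Homotopy.

(** * The unit interval as a retract of the line *)

Section Clamp.
Variable R : realType.

Lemma clamp_subproof (t : R) :
  Num.max 0 (Num.min 1 t) \in (`[0, 1]%classic : set R).
Proof.
by rewrite inE /= in_itv /= le_max lexx ge_max ler01 ge_min lexx.
Qed.

Definition clamp (t : R) : uinterval R := SigSub (clamp_subproof t).

Lemma val_clamp (t : R) : 0 <= t <= 1 -> \val (clamp t) = t.
Proof. by move=> /andP[t0 t1] /=; rewrite (min_r t1) (max_r t0). Qed.

Lemma clampK (t : uinterval R) : clamp (\val t) = t.
Proof.
apply: val_inj; rewrite val_clamp //.
by have := valP t; rewrite inE /= in_itv.
Qed.

Lemma val_uinterval_continuous : continuous (\val : uinterval R -> R).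
Proof. exact: initial_continuous. Qed.

Lemma clamp_continuous : continuous clamp.
Proof.
apply: continuous_comp_initial => t.
apply: continuous_max; first exact: cvg_cst.
by apply: continuous_min; [exact: cvg_cst | exact: cvg_id].
Qed.

Lemma uinterval_compact : compact [set: uinterval R].
Proof.
rewrite (_ : setT = clamp @` `[0, 1]%classic).
  apply: continuous_compact; last exact: segment_compact.
  exact/continuous_subspaceT/clamp_continuous.
apply/seteqP; split=> // t _; exists (\val t); last exact: clampK.
by have := valP t; rewrite inE.
Qed.

End Clamp.

(** * Maps out of glued spaces *)

Section Gluing.
Variables (T : topologicalType) (r : T -> T -> Prop).

Lemma glue_pi_eq (a b : T) : r a b -> glue_pi r a = glue_pi r b.
Proof. by move=> ab; apply/eqquotP/asboolP; exact: rst_step. Qed.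

Lemma glue_pi_surj (z : glued r) : exists a, z = glue_pi r a.
Proof. by exists (repr z); rewrite /glue_pi reprK. Qed.

(** The target is an arbitrary type because the projection of the alternating
    cone to one copy of X takes values in an option type without a topology. *)
Definition glue_lift (U : Type) (f : T -> U) (z : glued r) : U := f (repr z).

Lemma glue_liftE (U : Type) (f : T -> U) :
  (forall a b, r a b -> f a = f b) ->
  forall a, glue_lift f (glue_pi r a) = f a.
Proof.
move=> fr a; rewrite /glue_lift.
have /eqquotP/asboolP : repr (glue_pi r a) = a %[mod {eq_quot glue_equiv r}].
  by rewrite reprK.
by move: (repr _) => b;
  elim=> [{}a {}b /fr||{}a {}b _ ->|{}a {}b d _ -> _ ->].
Qed.

Lemma glue_open (A : set (glued r)) : open (glue_pi r @^-1` A) -> open A.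
Proof. by []. Qed.

Lemma glue_pi_continuous : continuous (glue_pi r).
Proof. exact: pi_continuous. Qed.

Lemma glue_lift_continuous (U : topologicalType) (f : T -> U) :
  (forall a b, r a b -> f a = f b) -> continuous f -> continuous (glue_lift f).
Proof.
move=> fr /continuousP cf; apply/continuousP => A oA; apply: glue_open.
rewrite (_ : _ @^-1` _ = f @^-1` A); first exact: cf.
by apply/seteqP; split => a /=; rewrite glue_liftE.
Qed.

End Gluing.

(** * The chain with its point at infinity *)

Section Chain.
Variables (R : realType) (X : topologicalType) (x : X).

Local Notation I := (uinterval R).
Local Notation Y := (chain_infty R x).

Definition inX (n : nat) (p : X) : Y :=
  Some (glue_pi (chain_rel x) (sumX R n p)).
Definition inJ (n : nat) (t : I) : Y :=
  Some (glue_pi (chain_rel x) (sumJ X n t)).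

Lemma chain_infty_ind (P : Y -> Prop) :
  P None -> (forall n p, P (inX n p)) -> (forall n t, P (inJ n t)) ->
  forall y, P y.
Proof.
move=> P0 PX PJ [z|//]; have [[[n p|n t]] ->] := glue_pi_surj z.
- exact: PX.
- exact: PJ.
Qed.

Lemma inX_chainX n (y : Y) :
  (Some @` @chainX R X x n) y <-> exists p, y = inX n p.
Proof.
split=> [[_ [p _ <-] <-]|[p ->]]; first by exists p.
by eexists; [exists p|].
Qed.

Lemma Some_continuous : continuous (Some : chain_space R x -> Y).
Proof. by apply/continuousP => U [oU _]. Qed.

Lemma inX_continuous n : continuous (inX n).
Proof.
apply: comp_continuous Some_continuous.
apply: comp_continuous (@glue_pi_continuous _ _).
exact: (@existT_continuous _ (@chain_piece R X) (inl n)).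
Qed.

Lemma inJ_continuous n : continuous (inJ n).
Proof.
apply: comp_continuous Some_continuous.
apply: comp_continuous (@glue_pi_continuous _ _).
exact: (@existT_continuous _ (@chain_piece R X) (inr n)).
Qed.

Lemma nbhs_infty (V : set Y) : nbhs (None : Y) V ->
  exists m, forall k, (m < k)%N ->
    (forall p, V (inX k p)) /\ (forall t, V (inJ k t)).
Proof.
rewrite nbhsE => -[U [[_ oU] /oU[m mU]] UV]; exists m => k mk.
by split=> [p|t]; apply/UV/mU; right; eexists => //; left; exists k => //;
   [left; exists p | right; exists t].
Qed.

(** If infinity is not a cluster point of a filter, then the filter lives on
    the finitely many pieces outside of some neighborhood of infinity. *)
Lemma chain_infty_compact : compact [set: X] -> compact [set: Y].
Proof.
move=> cX F PF _.
have [|nF] := pselect (cluster F (None : Y)); first by exists None.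
move/existsNP : nF => [A /existsNP[V /not_implyP[FA /not_implyP[nV AV]]]].
have [m mV] := nbhs_infty nV.
pose L k : set Y := range (inX k) `|` range (inJ k).
pose K := \bigcup_(k in `I_m.+1) L k.
have cK : compact K.
  rewrite /K bigcup_mkord; apply: bigsetU_compact => k _.
  apply: compactU; apply: continuous_compact.
  - exact/continuous_subspaceT/inX_continuous.
  - exact: cX.
  - exact/continuous_subspaceT/inJ_continuous.
  - exact: uinterval_compact.
have FK : F K.
  apply: filterS FA => y Ay; apply: contrapT => nKy; apply: AV.
  exists y; split=> //; elim/chain_infty_ind: y Ay nKy => [_ _|k p _|k t _];
    first exact: nbhs_singleton nV.
  - have [km|/mV[] //] := leqP k m.
    by case; exists k => //; left; exists p.
  - have [km|/mV[] //] := leqP k m.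
    by case; exists k => //; right; exists t.
by have [y [_ Fy]] := cK F PF FK; exists y.
Qed.

(** A map out of Y, given by its restrictions to the copies of X and to the
    arcs, that takes the constant value c near infinity. *)
Section Extend.
Variables (T : topologicalType) (fX : nat -> X -> T) (fJ : nat -> I -> T).
Variables (c : T) (m : nat).
Hypothesis fXJ0 : forall n t, \val t = 0 -> fJ n t = fX n x.
Hypothesis fXJ1 : forall n t, \val t = 1 -> fJ n t = fX n.+1 x.
Hypothesis cfX : forall n, continuous (fX n).
Hypothesis cfJ : forall n, continuous (fJ n).
Hypothesis fX_far : forall n p, (m < n)%N -> fX n p = c.
Hypothesis fJ_far : forall n t, (m <= n)%N -> fJ n t = c.

Definition sum_map (a : chain_sum R X) : T :=
  match a with
  | existT i q => match i return chain_piece R X i -> T with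
                  | inl n => fX n | inr n => fJ n end q
  end.

Definition chain_map (y : Y) : T :=
  if y is Some z then glue_lift sum_map z else c.

Lemma sum_map_rel a b : chain_rel x a b -> sum_map a = sum_map b.
Proof.
by case=> n [t [-> [[t0 ->]|[t1 ->]]]] /=; [exact: fXJ0 | exact: fXJ1].
Qed.

Lemma chain_mapX n p : chain_map (inX n p) = fX n p.
Proof. exact: (glue_liftE sum_map_rel). Qed.

Lemma chain_mapJ n t : chain_map (inJ n t) = fJ n t.
Proof. exact: (glue_liftE sum_map_rel). Qed.

Lemma chain_map_continuous : continuous chain_map.
Proof.
apply/continuousP => U oU; split.
  have : continuous (glue_lift sum_map : chain_space R x -> T).
    apply: glue_lift_continuous; first exact: sum_map_rel.
    by move=> [[n|n] q] W /= nW; [exact: cfX nW | exact: cfJ nW].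
  by move/continuousP; apply.
move=> Uc; exists m => y [->//|[z h <-]].
suff e : chain_map (Some z) = c by rewrite -[_ (Some z)]/(U (chain_map _)) e.
case: h => [[k /= mk]|] => [[|]|[]] [q _ <-].
- by rewrite [LHS]chain_mapX fX_far.
- by rewrite [LHS]chain_mapJ fJ_far // ltnW.
- by move=> _; rewrite [LHS]chain_mapJ fJ_far.
Qed.

End Extend.
End Chain.

(** * The alternating cone and the projection of one of its cones *)

Section Cone.
Variables (R : realType) (X : topologicalType) (x : X).

Local Notation I := (uinterval R).
Local Notation Y := (chain_infty R x).
Local Notation AC := (alternating_cone R x).

(** The height of the vertex of the n-th cone: the end at which the n-th copy
    of X is collapsed. *)
Definition level (n : nat) : R := (odd n)%:R.

Definition AC_pi (y : Y) (t : I) : AC :=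
  glue_pi (@AC_collapse R X x : Y * I -> Y * I -> Prop) (y, t).

Lemma AC_pi_surj (a : AC) : exists y t, a = AC_pi y t.
Proof. by have [[y t] ->] := glue_pi_surj a; exists y, t. Qed.

Lemma AC_pi_continuous : continuous (fun q : Y * I => AC_pi q.1 q.2).
Proof.
rewrite (_ : (fun q => _) =
    glue_pi (@AC_collapse R X x : Y * I -> Y * I -> Prop)).
  exact: glue_pi_continuous.
by apply/funext => -[].
Qed.

Lemma AC_collapseP (a b : Y * I) : AC_collapse a b <->
  exists n p q, [/\ a.1 = inX R x n p, b.1 = inX R x n q,
    \val a.2 = level n & \val b.2 = level n].
Proof.
split.
  case=> n [/inX_chainX[p ap] /inX_chainX[q bq] lev]; exists n, p, q.
  rewrite /level; case: lev => -[] /=; first by move=> /negbTE -> [-> ->].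
  by rewrite negbK => -> [-> ->].
case=> n [p [q [ap bq]]]; rewrite /level => an bn; exists n.
split; [by apply/inX_chainX; exists p | by apply/inX_chainX; exists q |].
by move: an bn; rewrite /=; case: odd => /=; [right | left].
Qed.

Lemma AC_pi_level n p q t : \val t = level n ->
  AC_pi (inX R x n p) t = AC_pi (inX R x n q) t.
Proof. by move=> tn; apply/glue_pi_eq/AC_collapseP; exists n, p, q. Qed.

Definition height : AC -> R := glue_lift (fun q : Y * I => \val q.2).

Lemma heightE y t : height (AC_pi y t) = \val t.
Proof.
apply: (glue_liftE (f := fun q : Y * I => \val q.2)).
by move=> a b /AC_collapseP[n [p [q [_ _ -> ->]]]].
Qed.

Lemma height_continuous : continuous height.
Proof.
apply: glue_lift_continuous.
  by move=> a b /AC_collapseP[n [p [q [_ _ -> ->]]]].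
apply: (@comp_continuous (Y * I)%type I R snd (\val : I -> R)).
  exact: snd_continuous.
exact: val_uinterval_continuous.
Qed.

Section Copy.
Variable n : nat.

Definition retrX (k : nat) (p : X) : X := if k == n then p else x.

Definition copy_retr : Y -> X := chain_map retrX (fun _ _ => x) x.

Lemma retrX_basepoint k : retrX k x = x.
Proof. by rewrite /retrX; case: ifP. Qed.

Lemma copy_retrE k p : copy_retr (inX R x k p) = retrX k p.
Proof. by apply: chain_mapX => *; rewrite retrX_basepoint. Qed.

Lemma copy_retr_continuous : continuous copy_retr.
Proof.
apply: (chain_map_continuous (m := n)) => //;
  do ?[by move=> *; rewrite retrX_basepoint].
- move=> k; rewrite /retrX.
  by case: (k == n) => p; [exact: cvg_id | exact: cvg_cst].
- by move=> k; exact: cst_continuous.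
- by move=> k p nk; rewrite /retrX gtn_eqF.
Qed.

Definition distX (k : nat) (p : X) : R := if k == n then 0 else 1.
Definition distJ (k : nat) (t : I) : R :=
  if k == n then \val t else if k.+1 == n then 1 - \val t else 1.

(** The n-th copy of X is the zero set of this function, hence closed in Y even
    if the point x is not closed in X. *)
Definition copy_dist : Y -> R := chain_map distX distJ 1.

Lemma distJ0 k (t : I) : \val t = 0 -> distJ k t = distX k x.
Proof. by rewrite /distJ /distX => ->; rewrite subr0 if_same. Qed.

Lemma distJ1 k (t : I) : \val t = 1 -> distJ k t = distX k.+1 x.
Proof.
rewrite /distJ /distX => ->; rewrite subrr.
by have [->|//] := eqVneq k n; rewrite gtn_eqF.
Qed.

Lemma copy_distE k p : copy_dist (inX R x k p) = distX k p.
Proof. by apply: chain_mapX; [exact: distJ0 | exact: distJ1]. Qed.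

Lemma copy_dist_continuous : continuous copy_dist.
Proof.
apply: (chain_map_continuous (m := n.+1)).
- exact: distJ0.
- exact: distJ1.
- by move=> k p; exact: cvg_cst.
- move=> k; rewrite /distJ; case: (k == n).
    exact: val_uinterval_continuous.
  case: (k.+1 == n); last exact: cst_continuous.
  apply: (@comp_continuous I R R (\val : I -> R) (fun r => 1 - r)).
    exact: val_uinterval_continuous.
  by move=> r; apply: cvgB; [exact: cvg_cst | exact: cvg_id].
- by move=> k p nk; rewrite /distX gtn_eqF // ltnW.
- by move=> k t nk; rewrite /distJ !gtn_eqF // ltnW.
Qed.

(** [None] stands for the vertex of the n-th cone; no topology is put on the
    option type, continuity is stated away from [None]. *)
Definition pre_proj (q : Y * I) : option X :=
  if (copy_dist q.1 == 0) && (\val q.2 == level n) then None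
  else Some (copy_retr q.1).

Lemma pre_proj_collapse (a b : Y * I) :
  AC_collapse a b -> pre_proj a = pre_proj b.
Proof.
case/AC_collapseP => k [p [q [ap bq ak bk]]].
rewrite /pre_proj ap bq ak bk !copy_distE !copy_retrE /distX /retrX.
by have [->|_] := eqVneq k n; rewrite ?eqxx // oner_eq0.
Qed.

Definition cone_proj : AC -> option X := glue_lift pre_proj.

Lemma cone_projE y t : cone_proj (AC_pi y t) = pre_proj (y, t).
Proof. exact: (glue_liftE pre_proj_collapse). Qed.

Lemma cone_projX p t : \val t != level n ->
  cone_proj (AC_pi (inX R x n p) t) = Some p.
Proof.
move=> /negbTE tn; rewrite cone_projE /pre_proj tn andbF; congr Some.
by rewrite [LHS]copy_retrE /retrX eqxx.
Qed.

Lemma cone_proj_None a : cone_proj a = None -> height a = level n.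
Proof.
have [y [t ->]] := AC_pi_surj a; rewrite cone_projE heightE /pre_proj /=.
by case: ifP => // /andP[_ /eqP].
Qed.

(** The points that are not sent to [None] form an open set, on the preimage of
    which in the product of Y with [0, 1] the projection is the retraction of Y
    to the n-th copy. *)
Lemma cone_proj_continuous (S : topologicalType) (g : S -> AC) :
  continuous g -> (forall s, cone_proj (g s) != None) ->
  continuous (fun s => odflt x (cone_proj (g s))).
Proof.
move=> /continuousP cg gN; apply/continuousP => U oU.
pose V : set AC := [set a | cone_proj a != None /\ U (odflt x (cone_proj a))].
rewrite (_ : _ @^-1` U = g @^-1` V); last first.
  by apply/seteqP; split=> s //= [].
apply: cg; apply: glue_open.
have -> : glue_pi (@AC_collapse R X x : Y * I -> Y * I -> Prop) @^-1` V =
    ((fun q : Y * I => copy_dist q.1) @^-1` [set~ 0] `|`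
     (fun q : Y * I => \val q.2) @^-1` [set~ level n]) `&`
    (fun q : Y * I => copy_retr q.1) @^-1` U.
  apply/seteqP; split=> -[y t];
    rewrite /V /= -/(AC_pi y t) cone_projE /pre_proj /=.
    case: ifP => [_ [/eqP //]|/negbT].
    by rewrite negb_and => /orP[] /eqP ? [_ ?]; split=> //; [left | right].
  case=> dl Uy; case: ifP => // /andP[/eqP d /eqP l].
  by case: dl; [rewrite d|rewrite l].
apply: openI; [apply: openU|].
- apply: open_comp; last by apply: closed_openC; exact: closed_eq.
  move=> q _; apply: (@comp_continuous (Y * I)%type Y R fst copy_dist).
    exact: fst_continuous.
  exact: copy_dist_continuous.
- apply: open_comp; last by apply: closed_openC; exact: closed_eq.
  move=> q _; apply: (@comp_continuous (Y * I)%type I R snd (\val : I -> R)).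
    exact: snd_continuous.
  exact: val_uinterval_continuous.
- apply: open_comp => // q _.
  apply: (@comp_continuous (Y * I)%type Y X fst copy_retr).
    exact: fst_continuous.
  exact: copy_retr_continuous.
Qed.

End Copy.

Lemma alternating_cone_compact : compact [set: X] -> compact [set: AC].
Proof.
move=> cX.
rewrite (_ : setT = (fun q : Y * I => AC_pi q.1 q.2) @` [set: Y * I]);
  last first.
  apply/seteqP; split=> // a _.
  by have [y [t ->]] := AC_pi_surj a; exists (y, t).
apply: continuous_compact.
  exact/continuous_subspaceT/AC_pi_continuous.
rewrite (_ : setT = setT `*` setT); last by apply/seteqP; split.
by apply: compact_setX; [exact: chain_infty_compact | exact: uinterval_compact].
Qed.

End Cone.

(** * Following the n-th copy during a contraction *)

Lemma homotopic_id_cst_contractible (R : realType) (X : topologicalType)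
    (c : X) :
  homotopic R (fun p : X => p) (fun=> c) -> contractible R X.
Proof.
move=> [K [cK K0 K1]]; exists c, (fun q => K (q.1, \val q.2)); split.
- apply: (@comp_continuous (X * uinterval R)%type (X * R)%type X
    (fun q => (q.1, \val q.2)) K) => //.
  apply: pair_continuous; first exact: fst_continuous.
  apply: (@comp_continuous (X * uinterval R)%type (uinterval R) R snd
    (\val : uinterval R -> R)); first exact: snd_continuous.
  exact: val_uinterval_continuous.
- by move=> p t /= ->.
- by move=> p t /= ->.
Qed.

Lemma between_convex (R : realType) (a b u v r : R) :
  a <= u <= b -> a <= v <= b -> 0 <= r <= 1 -> a <= u + r * (v - u) <= b.
Proof.
move=> /andP[au ub] /andP[av vb] /andP[r0 r1].
have r1' : 0 <= 1 - r by rewrite subr_ge0.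
have : 0 <= (1 - r) * (u - a) + r * (v - a).
  by rewrite addr_ge0 // mulr_ge0 // subr_ge0.
have : 0 <= (1 - r) * (b - u) + r * (b - v).
  by rewrite addr_ge0 // mulr_ge0 // subr_ge0.
by move=> ? ?; apply/andP; split; nra.
Qed.

Section Contraction.
Variables (R : realType) (X : topologicalType) (x : X).

Local Notation I := (uinterval R).
Local Notation Y := (chain_infty R x).
Local Notation AC := (alternating_cone R x).

Variables (c : AC) (H : AC * I -> AC).
Hypothesis cH : continuous H.
Hypothesis H0 : forall (a : AC) (t : I), \val t = 0 -> H (a, t) = a.
Hypothesis H1 : forall (a : AC) (t : I), \val t = 1 -> H (a, t) = c.

Definition flow (y : Y) (u s : R) : AC := H (AC_pi y (clamp u), clamp s).

Lemma flow_continuous :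
  continuous (fun q : Y * (R * R) => flow q.1 q.2.1 q.2.2).
Proof.
apply: (@comp_continuous (Y * (R * R))%type (AC * I)%type AC
  (fun q => (AC_pi q.1 (clamp q.2.1), clamp q.2.2)) H) => //.
have c2 : continuous (snd : Y * (R * R) -> R * R) by exact: snd_continuous.
apply: pair_continuous.
  apply: (@comp_continuous (Y * (R * R))%type (Y * I)%type AC
    (fun q => (q.1, clamp q.2.1)) (fun q => AC_pi q.1 q.2));
    last exact: AC_pi_continuous.
  apply: pair_continuous; first exact: fst_continuous.
  apply: (comp_continuous _ (@clamp_continuous R)).
  exact: (comp_continuous c2 (@fst_continuous _ _)).
apply: (comp_continuous _ (@clamp_continuous R)).
exact: (comp_continuous c2 (@snd_continuous _ _)).
Qed.

Lemma flow0 y u : flow y u 0 = AC_pi y (clamp u).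
Proof. by apply: H0; rewrite val_clamp // lexx ler01. Qed.

Lemma flow1 y u : flow y u 1 = c.
Proof. by apply: H1; rewrite val_clamp // lexx ler01. Qed.

Definition shadow (n : nat) (u s : R) (p : X) : option X :=
  cone_proj n (flow (inX R x n p) u s).

Definition essential (n : nat) (u s : R) : Prop :=
  (forall p, shadow n u s p != None) /\
  ~ exists d : X, homotopic R (fun p => odflt x (shadow n u s p)) (fun=> d).

(** Along the segment between the two points of the box the vertex is avoided,
    so this segment gives a homotopy between the two maps from X to X. *)
Lemma essential_box n (u0 u1 s0 s1 u u' s s' : R) :
  u0 <= u <= u1 -> u0 <= u' <= u1 -> s0 <= s <= s1 -> s0 <= s' <= s1 ->
  (forall p v r, u0 <= v <= u1 -> s0 <= r <= s1 -> shadow n v r p != None) ->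
  essential n u s -> essential n u' s'.
Proof.
move=> uP u'P sP s'P tN [_ ess]; split; first by move=> p; exact: tN.
move=> [d nul]; apply: ess; exists d; apply: homotopic_trans nul.
pose w (t : R) := \val (clamp t).
have w01 t : 0 <= w t <= 1.
  by have := valP (clamp t); rewrite inE /= in_itv.
have cw : continuous w.
  exact: (comp_continuous (@clamp_continuous R) (@val_uinterval_continuous R)).
pose pt (t : R) := (u + w t * (u' - u), s + w t * (s' - s)).
have cpt : continuous pt.
  by apply: pair_continuous => t; (apply: cvgD; first exact: cvg_cst);
    (apply: cvgM; last exact: cvg_cst); exact: cw.
exists (fun q : X * R => odflt x (shadow n (pt q.2).1 (pt q.2).2 q.1)).
split=> [|p|p]; last 2 first.
- have w0 : w 0 = 0 by rewrite /w val_clamp // lexx ler01.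
  by rewrite /pt w0 !mul0r !addr0.
- have w1 : w 1 = 1 by rewrite /w val_clamp // lexx ler01.
  by rewrite /pt w1 !mul1r ![_ + (_ - _)]addrC !subrK.
apply: cone_proj_continuous => [|q]; last first.
  by apply: tN => /=; exact: between_convex.
apply: (@comp_continuous (X * R)%type (Y * (R * R))%type AC
  (fun q => (inX R x n q.1, pt q.2)) (fun q => flow q.1 q.2.1 q.2.2));
  last exact: flow_continuous.
apply: pair_continuous.
  exact: (comp_continuous (@fst_continuous _ _) (@inX_continuous R X x n)).
exact: (comp_continuous (@snd_continuous _ _) cpt).
Qed.

Hypothesis ncX : ~ contractible R X.

Lemma essential_start n u : 0 <= u <= 1 -> u != level R n -> essential n u 0.
Proof.
move=> u01 ul.
have tE p : shadow n u 0 p = Some p.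
  by rewrite /shadow flow0 cone_projX // val_clamp.
split=> [p|[d hd]]; first by rewrite tE.
apply: ncX; apply: (@homotopic_id_cst_contractible _ _ d).
move: hd; rewrite (_ : (fun p => odflt x _) = fun p => p) //.
by apply/funext => p; rewrite tE.
Qed.

Lemma constant_not_essential n u s :
  (forall p q, shadow n u s p = shadow n u s q) -> ~ essential n u s.
Proof.
move=> tc [_]; apply; exists (odflt x (shadow n u s x)).
exists (fun=> odflt x (shadow n u s x)); split=> // [|p].
  exact: cst_continuous.
by rewrite (tc p x).
Qed.

Lemma not_essential_end n u : ~ essential n u 1.
Proof. by apply: constant_not_essential => p q; rewrite /shadow !flow1. Qed.

(** At the height of the vertex the whole copy of X is a single point. *)
Lemma not_essential_level n s : ~ essential n (level R n) s.
Proof.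
apply: constant_not_essential => p q; rewrite /shadow /flow.
rewrite (AC_pi_level x p q) // val_clamp // /level.
by case: odd; rewrite ?lexx ler01.
Qed.

(** Near infinity the heights along the flow are uniformly close to those of
    the point at infinity, because the square of all heights and times is
    compact.  The index N bounds both the copies and the mesh: the bound
    1 / (N + 2) makes a grid with at least two cells on each side. *)
Lemma height_near_infty : exists N : nat, forall n p (u s u' s' : R),
  (N < n)%N -> 0 <= u <= 1 -> 0 <= s <= 1 ->
  `|u - u'| <= N.+2%:R^-1 -> `|s - s'| <= N.+2%:R^-1 ->
  `|height (flow None u s) - height (flow (inX R x n p) u' s')| < 2^-1.
Proof.
pose K : set (R * R) := `[0, 1]%classic `*` `[0, 1]%classic.
have cK : compact K by apply: compact_setX; exact: segment_compact.
pose f (q : Y * (R * R)) := height (flow q.1 q.2.1 q.2.2).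
have cf : continuous f.
  exact: (comp_continuous flow_continuous (@height_continuous R X x)).
pose P (N : nat) (z : R * R) := forall n p z', (N < n)%N ->
  `|z.1 - z'.1| <= N.+2%:R^-1 -> `|z.2 - z'.2| <= N.+2%:R^-1 ->
  `|f (None, z) - f (inX R x n p, z')| < 2^-1.
have /compact_near_coveringP/(_ nat \oo P _) := cK.
case.
  move=> z Kz.
  have /cvgrPdist_lt/(_ 4^-1) := cf (None, z).
  rewrite invr_gt0 ltr0n => /(_ isT) [[V W] /= [nV nW] VW].
  have [m mV] := nbhs_infty nV.
  have /nbhs_ballP[e /= e0 eW] := nW.
  have Ve : V (None : Y) by exact: (nbhs_singleton (nV : nbhs (None : Y) V)).
  have e20 : 0 < e / 2 by rewrite divr_gt0.
  have Ne : \forall N \near \oo, N.+2%:R^-1 < e / 2 :> R.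
    apply: filterS (near_infty_natSinv_lt (PosNum e20)) => N /=.
    by apply: le_lt_trans; rewrite lef_pV2 ?posrE ?ltr0n // ler_nat.
  exists (ball z (e / 2), [set N | (m <= N)%N /\ N.+2%:R^-1 < e / 2]).
    split; first exact: nbhsx_ballx.
    by apply: filterI => //; exact: nbhs_infty_ge.
  move=> [z' N] [/= [z1 z2] [mN e2]] n p z'' Nn d1 d2.
  rewrite /ball /= in z1 z2 d1 d2 Nn *.
  have mn : (m < n)%N by exact: leq_ltn_trans Nn.
  have Wz' : W z'.
    apply: eW; split; [have := z1|have := z2]; rewrite /ball /=; lra.
  have Wz'' : W z''.
    apply: eW; split; rewrite /ball /=.
      apply: (le_lt_trans (ler_distD z'.1 _ _)).
      by rewrite [e]splitr ltrD // (le_lt_trans d1).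
    apply: (le_lt_trans (ler_distD z'.2 _ _)).
    by rewrite [e]splitr ltrD // (le_lt_trans d2).
  have h1 := VW (None, z') (conj Ve Wz').
  have h2 := VW (inX R x n p, z'') (conj (proj1 (mV n mn) p) Wz'').
  apply: (le_lt_trans (ler_distD (f (None, z)) _ _)).
  have -> : 2^-1 = 4^-1 + 4^-1 :> R by lra.
  by rewrite distrC; exact: ltrD h1 h2.
move=> N _ NP; exists N => n p u s u' s' Nn u01 s01 du ds.
have := NP N (leqnn N) (u, s); rewrite /K /=.
by move=> /(_ _ n p (u', s')) -> //; rewrite !in_itv.
Qed.

Lemma shadow_None_height n u s p : shadow n u s p = None ->
  height (flow (inX R x n p) u s) = level R n.
Proof. exact: cone_proj_None. Qed.

Lemma essential_change_height n u0 u1 s0 s1 u u' s s' :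
  u0 <= u <= u1 -> u0 <= u' <= u1 -> s0 <= s <= s1 -> s0 <= s' <= s1 ->
  `[< essential n u s >] <> `[< essential n u' s' >] ->
  exists p v r, [/\ u0 <= v <= u1, s0 <= r <= s1 &
    height (flow (inX R x n p) v r) = level R n].
Proof.
move=> uP u'P sP s'P ne; apply: contrapT => no.
have tN p v r : u0 <= v <= u1 -> s0 <= r <= s1 -> shadow n v r p != None.
  move=> vP rP; apply/eqP => t0; apply: no; exists p, v, r.
  by split=> //; exact: shadow_None_height.
by apply: ne; apply: asbool_equiv_eq; split;
  by apply: essential_box tN.
Qed.

(** [grid_crossing] for the copies [ne] and [no], with vertices at the heights
    0 and 1, contradicts [height_near_infty]. *)
Lemma no_contraction : False.
Proof.
have [N near_infty] := height_near_infty.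
pose M := N.+2; pose node (i : nat) : R := i%:R / M%:R.
have M0 : 0 < M%:R :> R by rewrite ltr0n.
have node01 i : (i <= M)%N -> 0 <= node i <= 1.
  by move=> iM; rewrite divr_ge0 ?ler0n //= ler_pdivrMr // mul1r ler_nat.
have nodeS i : node i.+1 = node i + M%:R^-1.
  by rewrite /node -natr1 mulrDl mul1r.
pose bits n i j := `[< essential n (node i) (node j) >].
have bitsP n i j : ~ essential n (node i) (node j) -> bits n i j = false.
  by move=> ness; apply/negbTE/asboolPn.
have node0 : node 0 = 0 by rewrite /node mul0r.
have nodeM : node M = 1 by rewrite /node divff // gt_eqF.
pose ne := (2 * N + 2)%N; pose no := (2 * N + 3)%N.
have level_e : level R ne = 0.
  by rewrite /level /ne; have -> : odd (2 * N + 2) = false by lia.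
have level_o : level R no = 1.
  by rewrite /level /no; have -> : odd (2 * N + 3) = true by lia.
have cell n i j : ~ cell_constant (bits n) i j -> exists p v r,
    [/\ `|node i - v| <= M%:R^-1, `|node j - r| <= M%:R^-1 &
        height (flow (inX R x n p) v r) = level R n].
  move=> ncell.
  have Mi : 0 <= M%:R^-1 :> R by rewrite invr_ge0 ler0n.
  have [k [l [kP lP kl]]] : exists k l, [/\ node i <= node k <= node i.+1,
      node j <= node l <= node j.+1 & bits n k l <> bits n i j].
    apply: contrapT => nokl; apply: ncell.
    have good k l : node i <= node k <= node i.+1 ->
        node j <= node l <= node j.+1 -> bits n k l = bits n i j.
      by move=> kP lP; apply: contrapT => kl; apply: nokl; exists k, l.
    by split; apply: good; rewrite ?nodeS ?lexx ?lerDl ?Mi.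
  have [||p [v [r [/andP[v0 v1] /andP[r0 r1] h]]]] :=
    @essential_change_height n (node i) (node i.+1) (node j) (node j.+1)
      _ _ _ _ kP _ lP _ kl.
  - by rewrite nodeS lexx lerDl.
  - by rewrite nodeS lexx lerDl.
  exists p, v, r; split=> //.
  - by rewrite distrC ger0_norm ?subr_ge0 // lerBlDl -nodeS.
  - by rewrite distrC ger0_norm ?subr_ge0 // lerBlDl -nodeS.
have [|j|j|i|i /andP[i0 iM]|i iM|] := @grid_crossing M (bits ne) (bits no).
- by [].
- by apply: bitsP; rewrite node0 -level_e; exact: not_essential_level.
- by apply: bitsP; rewrite nodeM -level_o; exact: not_essential_level.
- by apply: bitsP; rewrite nodeM; exact: not_essential_end.
- apply/asboolP; rewrite node0; apply: essential_start; first exact: node01.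
  by rewrite level_e mulf_neq0 ?invr_neq0 ?pnatr_eq0 // -lt0n.
- apply/asboolP; rewrite node0; apply: essential_start; first exact/node01/ltnW.
  by rewrite level_o lt_eqF // ltr_pdivrMr // mul1r ltr_nat.
move=> i [j [iM jM /cell[p [v [r [iv jr hp]]]]]].
move=> /cell[q [v' [r' [iv' jr' hq]]]].
have i01 := node01 i (ltnW iM); have j01 := node01 j (ltnW jM).
have := near_infty ne p _ _ v r _ i01 j01 iv jr.
have := near_infty no q _ _ v' r' _ i01 j01 iv' jr'.
rewrite hp hq level_e level_o.
have -> : (N < no)%N by rewrite /no; lia.
have -> : (N < ne)%N by rewrite /ne; lia.
by move=> /(_ isT) + /(_ isT); rewrite !ltr_norml => /andP[? ?] /andP[? ?]; lra.
Qed.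

End Contraction.

Theorem theorem3p3 (R : realType) (X : topologicalType) (x : X)
    (cptX : compact [set: X]) (ncX : ~ contractible R X) :
  compact [set: alternating_cone R x] /\
  ~ contractible R (alternating_cone R x).
Proof.
split; first exact: alternating_cone_compact.
by move=> [c [H [cH H0 H1]]]; exact: (no_contraction cH H0 H1 ncX).
Qed.
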